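(* Let $\bar z\in\mathbb R^n$ be an implicitly M-stationary point of (P). Assume that $\widehat K$ is inner semicompact at $(\bar z,0)$ w.r.t. $\operatorname{dom}\widehat K$, and let $\widehat{\mathcal H}$ be metrically subregular at $((\bar z,0,\lambda),(0,0))$ for each $\lambda\in K(\bar z)$. Then $\bar z$ is fuzzily M-stationary. Moreover, $\bar z$ is also explicitly M-stationary if, for each $\lambda\in K(\bar z)$, the inclusion $$D^*\mathcal H((\bar z,\lambda),(0,0))(\mu,\nu)\subset D^*F(\bar z,\lambda)(\mu)\times\{-\mu\}+D^*G((\bar z,\lambda),0)(\nu)$$ holds for all $\mu\in\mathbb R^m$ and $\nu\in\mathbb R^s$.
   Context: Let $f\colon\mathbb R^n\to\mathbb R$ be locally Lipschitz continuous, let $F\colon\mathbb R^n\rightrightarrows\mathbb R^m$ and $G\colon\mathbb R^n\times\mathbb R^m\rightrightarrows\mathbb R^s$ be set-valued mappings with closed graphs, and let $M\subset\mathbb R^n$ be nonempty and closed. Set $H(z):=\bigcup_{\lambda\in F(z)}G(z,\lambda)$; it is assumed that $\operatorname{gph}H$ is (locally) closed. Problem (P): minimize $f(z)$ over $z\in\mathbb R^n$ subject to $0\in H(z)$, $z\in M$. Put $K(z):=\{\lambda\in F(z)\mid 0\in G(z,\lambda)\}$ and $\widehat K(z,w):=\{\lambda\in F(z)\mid w\in G(z,\lambda)\}$ for $z\in\mathbb R^n$, $w\in\mathbb R^s$. Auxiliary mappings: $\mathcal H(z,\lambda):=(F(z)-\lambda)\times G(z,\lambda)$ and $\widehat{\mathcal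 H}(z,w,\lambda):=(F(z)-\lambda)\times(G(z,\lambda)-w)$. Variational analysis: products carry the sum of Euclidean norms; $\operatorname{dist}(z,A)=\inf_{a\in A}\|a-z\|$ ($=+\infty$ if $A=\varnothing$). For a set-valued mapping $\Upsilon$, $\operatorname{dom}\Upsilon=\{z\mid\Upsilon(z)\neq\varnothing\}$ and $\Upsilon^{-1}(w)=\{z\mid w\in\Upsilon(z)\}$. $\Upsilon$ is metrically subregular at $(\bar z,\bar w)\in\operatorname{gph}\Upsilon$ if there are $\kappa>0$ and a neighborhood $U$ of $\bar z$ with $\operatorname{dist}(z,\Upsilon^{-1}(\bar w))\le\kappa\operatorname{dist}(\bar w,\Upsilon(z))$ for all $z\in U$. $\Upsilon$ is inner semicompact at $\bar z\in\operatorname{dom}\Upsilon$ w.r.t. a set $\Omega$ if for each sequence $\{z_k\}\subset\Omega$ with $z_k\to\bar z$ there are a subsequence $\{z_{k_l}\}$ and a convergent sequence $\{w_l\}$ with $w_l\in\Upsilon(z_{k_l})$ for all $l$. For a closed set $A$ and $\bar z\in A$: $\mathcal T_A(\bar z)$ is the Bouligand tangent cone, $\widehat{\mathcal N}_A(\bar z)$ its polar, and the limiting normal cone $\mathcal N_A(\bar z)$ consists of all limits $\xi=\lim\xi_k$ with $\xi_k\in\widehat{\mathcal N}_A(z_k)$, $z_k\in A$, $z_k\to\bar z$. Limiting subdifferential: $\partial f(\bar z)=\{\xi\mid(\xi,-1)\in\mathcal N_{\operatorname{epi}f}(\bar z,f(\bar z))\}$. Limiting coderivative: $D^*\Upsilon(\bar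 z,\bar w)(\eta)=\{\xi\mid(\xi,-\eta)\in\mathcal N_{\operatorname{gph}\Upsilon}(\bar z,\bar w)\}$. A feasible point $\bar z$ of (P) is called - implicitly M-stationary if there is $\nu\in\mathbb R^s$ with $0\in\partial f(\bar z)+D^*H(\bar z,0)(\nu)+\mathcal N_M(\bar z)$; - fuzzily M-stationary if there are $\bar\lambda\in K(\bar z)$, $\mu\in\mathbb R^m$, $\nu\in\mathbb R^s$ with $(0,0)\in\partial f(\bar z)\times\{0\}+D^*\mathcal H((\bar z,\bar\lambda),(0,0))(\mu,\nu)+\mathcal N_M(\bar z)\times\{0\}$; - explicitly M-stationary if there are $\bar\lambda\in K(\bar z)$, $\mu\in\mathbb R^m$, $\nu\in\mathbb R^s$ with $0\in\partial f(\bar z)+D^*F(\bar z,\bar\lambda)(\mu)+\{\xi\in\mathbb R^n\mid(\xi,\mu)\in D^*G((\bar z,\bar\lambda),0)(\nu)\}+\mathcal N_M(\bar z)$. *)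

(* Defs.v *)
From HB Require Import structures.
From mathcomp Require Import all_boot all_order all_algebra.
From mathcomp Require Import all_classical all_reals all_analysis.
From mathcomp Require Import ring lra.

Set Implicit Arguments.
Unset Strict Implicit.
Unset Printing Implicit Defensive.

Import Order.TTheory GRing.Theory Num.Theory.
Import numFieldNormedType.Exports.

Local Open Scope classical_set_scope.
Local Open Scope ring_scope.

(* The library norm on row vectors and on products is the max norm.  It is     *)
(* used for the topology only; a [euclideanType] carries in addition           *)
(* - the inner product [inner], with respect to which polars are taken;        *)
(* - an equivalent norm [enorm], with respect to which distances are taken.    *)
(* On R^n and R, [enorm] is induced by [inner]; on a product, [inner] is the   *)
(* sum of the inner products, but [enorm] is the SUM of the factor norms.      *)
HB.mixin Record NormedModule_isEuclidean (R : realType) E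
    of NormedModule R E := {
  inner : E -> E -> R ;
  innerC : forall x y, inner x y = inner y x ;
  innerDl : forall x y z, inner (x + y) z = inner x z + inner y z ;
  innerZl : forall a x y, inner (a *: x) y = a * inner x y ;
  inner_gt0 : forall x, x != 0 -> 0 < inner x x ;
  enorm : E -> R ;
  enormD : forall x y, enorm (x + y) <= enorm x + enorm y ;
  enormZ : forall a x, enorm (a *: x) = `|a| * enorm x ;
  enorm_equiv : exists2 C : R, 0 < C &
    forall x, `|x| <= C * enorm x /\ enorm x <= C * `|x|
}.

#[short(type="euclideanType")]
HB.structure Definition Euclidean (R : realType) :=
  { E of NormedModule R E & NormedModule_isEuclidean R E }.

Section row_vectors.
Context {R : realType} {n : nat}.
Implicit Types x y z : 'rV[R]_n.

Definition rV_inner x y : R := \sum_(i < n) x ord0 i * y ord0 i.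
Definition rV_enorm x : R := Num.sqrt (rV_inner x x).

Local Notation ip := rV_inner.

Fact rV_innerC x y : ip x y = ip y x.
Proof. by apply: eq_bigr => i _; rewrite mulrC. Qed.

Fact rV_innerDl x y z : ip (x + y) z = ip x z + ip y z.
Proof. by rewrite -big_split; apply: eq_bigr => i _; rewrite mxE mulrDl. Qed.

Fact rV_innerZl a x y : ip (a *: x) y = a * ip x y.
Proof. by rewrite mulr_sumr; apply: eq_bigr => i _; rewrite mxE mulrA. Qed.

Let rV_inner_ge0 x : 0 <= ip x x.
Proof. by apply: sumr_ge0 => i _; rewrite -expr2 sqr_ge0. Qed.

Let le_coord_inner x i : x ord0 i ^+ 2 <= ip x x.
Proof.
rewrite /ip /rV_inner (bigD1 i)//= -expr2 lerDl.
by apply: sumr_ge0 => j _; rewrite -expr2 sqr_ge0.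
Qed.

Fact rV_inner_gt0 x : x != 0 -> 0 < ip x x.
Proof.
move=> x0; rewrite lt0r rV_inner_ge0 andbT; apply: contra x0 => /eqP ip0.
apply/eqP/rowP => i; rewrite mxE; apply/eqP.
by rewrite -sqrf_eq0 eq_le sqr_ge0 andbT -ip0 le_coord_inner.
Qed.

Let cauchy_schwarz x y : ip x y <= rV_enorm x * rV_enorm y.
Proof.
have [->|y0] := eqVneq y 0.
  rewrite (_ : ip x 0 = 0) ?mulr_ge0 ?sqrtr_ge0//.
  by rewrite /ip /rV_inner big1// => i _; rewrite mxE mulr0.
have yy := rV_inner_gt0 y0.
have sq : ip x y ^+ 2 <= ip x x * ip y y.
  have := rV_inner_ge0 (ip y y *: x + (- ip x y) *: y).
  have ipDr u v w : ip u (v + w) = ip u v + ip u w.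
    by rewrite !(rV_innerC u) rV_innerDl.
  have ipZr a u v : ip u (a *: v) = a * ip u v.
    by rewrite !(rV_innerC u) rV_innerZl.
  rewrite !(rV_innerDl, ipDr, rV_innerZl, ipZr) (rV_innerC y x) => h.
  by rewrite -(ler_pM2l yy); move: h; lra.
have [neg|pos] := ltP (ip x y) 0.
  by apply: (le_trans (ltW neg)); rewrite mulr_ge0 ?sqrtr_ge0.
rewrite /rV_enorm -sqrtrM// -(ger0_norm pos) -sqrtr_sqr.
exact: ler_wsqrtr.
Qed.

Fact rV_enormD x y : rV_enorm (x + y) <= rV_enorm x + rV_enorm y.
Proof.
have sq u : rV_enorm u ^+ 2 = ip u u by rewrite sqr_sqrtr.
have e0 u : 0 <= rV_enorm u by exact: sqrtr_ge0.
rewrite -(@ler_pXn2r _ 2)// ?nnegrE ?addr_ge0//.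
rewrite sqrrD !sq !(rV_innerDl, rV_innerC _ (x + y)) (rV_innerC y x).
have := cauchy_schwarz x y; lra.
Qed.

Fact rV_enormZ a x : rV_enorm (a *: x) = `|a| * rV_enorm x.
Proof.
rewrite /rV_enorm rV_innerZl (rV_innerC x) rV_innerZl mulrA -expr2.
by rewrite sqrtrM ?sqr_ge0// sqrtr_sqr.
Qed.

Fact rV_enorm_equiv : exists2 C : R, 0 < C &
  forall x, `|x| <= C * rV_enorm x /\ rV_enorm x <= C * `|x|.
Proof.
have coord x i : `|x ord0 i| <= `|x|.
  by rewrite [leRHS]mx_normrE (le_bigmax _ (fun ij => `|x ij.1 ij.2|) (ord0, i)).
exists n.+1%:R => // x; split.
  apply: (@le_trans _ _ (rV_enorm x)); last first.
    by rewrite ler_peMl ?sqrtr_ge0// ler1n.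
  rewrite [leLHS]mx_normrE; apply/bigmax_leP; split; first exact: sqrtr_ge0.
  move=> [i j] _ /=; rewrite (ord1 i) -sqrtr_sqr.
  exact/ler_wsqrtr/le_coord_inner.
have -> : n.+1%:R * `|x| = Num.sqrt ((n.+1%:R * `|x|) ^+ 2).
  by rewrite sqrtr_sqr ger0_norm// mulr_ge0.
apply: ler_wsqrtr; apply: (@le_trans _ _ (\sum_(i < n) `|x| ^+ 2)).
  apply: ler_sum => i _; rewrite -expr2 -(real_normK (num_real _)).
  by rewrite lerXn2r ?nnegrE.
rewrite sumr_const card_ord -[leLHS]mulr_natl exprMn ler_wpM2r ?sqr_ge0//.
by rewrite -natrX ler_nat (leq_trans (leqnSn n))// -mulnn leq_pmulr.
Qed.

HB.instance Definition _ := NormedModule_isEuclidean.Build R 'rV[R]_n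
  rV_innerC rV_innerDl rV_innerZl rV_inner_gt0
  rV_enormD rV_enormZ rV_enorm_equiv.

End row_vectors.

Section real_line.
Context {R : realType}.

Definition R_inner (x y : R^o) : R := x * y.
Definition R_enorm (x : R^o) : R := `|x|.

Fact R_innerC x y : R_inner x y = R_inner y x. Proof. exact: mulrC. Qed.

Fact R_innerDl x y z : R_inner (x + y) z = R_inner x z + R_inner y z.
Proof. exact: mulrDl. Qed.

Fact R_innerZl a x y : R_inner (a *: x) y = a * R_inner x y.
Proof. by rewrite /R_inner mulrA. Qed.

Fact R_inner_gt0 x : x != 0 -> 0 < R_inner x x.
Proof. by move=> x0; rewrite /R_inner -expr2 exprn_even_gt0. Qed.

Fact R_enormD x y : R_enorm (x + y) <= R_enorm x + R_enorm y.
Proof. exact: ler_normD. Qed.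

Fact R_enormZ a x : R_enorm (a *: x) = `|a| * R_enorm x.
Proof. exact: normrM. Qed.

Fact R_enorm_equiv : exists2 C : R, 0 < C &
  forall x : R^o, `|x| <= C * R_enorm x /\ R_enorm x <= C * `|x|.
Proof. by exists 1 => // x; rewrite !mul1r. Qed.

HB.instance Definition _ := NormedModule_isEuclidean.Build R R^o
  R_innerC R_innerDl R_innerZl R_inner_gt0 R_enormD R_enormZ R_enorm_equiv.

End real_line.

Section products.
Context {R : realType} {E F : euclideanType R}.
Implicit Types p q r : (E * F)%type.

Definition prod_inner p q : R := inner p.1 q.1 + inner p.2 q.2.
Definition prod_enorm p : R := enorm p.1 + enorm p.2.

Fact prod_innerC p q : prod_inner p q = prod_inner q p.
Proof. by rewrite /prod_inner innerC (innerC p.2). Qed.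

Fact prod_innerDl p q r :
  prod_inner (p + q) r = prod_inner p r + prod_inner q r.
Proof. by rewrite /prod_inner !innerDl addrACA. Qed.

Fact prod_innerZl a p q : prod_inner (a *: p) q = a * prod_inner p q.
Proof. by rewrite /prod_inner !innerZl mulrDr. Qed.

Fact prod_inner_gt0 p : p != 0 -> 0 < prod_inner p p.
Proof.
have ge0 (G : euclideanType R) (x : G) : 0 <= inner x x.
  have [->|/inner_gt0/ltW//] := eqVneq x 0.
  by rewrite -(scale0r (0 : G)) innerZl mul0r.
case: p => x y; rewrite /prod_inner/=.
have [->|/inner_gt0 x0 _] := eqVneq x 0; last by rewrite ltr_pwDl ?ge0.
have [->|/inner_gt0 y0 _] := eqVneq y 0; first by rewrite eqxx.
by rewrite ltr_wpDl ?ge0.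
Qed.

Fact prod_enormD p q : prod_enorm (p + q) <= prod_enorm p + prod_enorm q.
Proof. by rewrite /prod_enorm addrACA lerD ?enormD. Qed.

Fact prod_enormZ a p : prod_enorm (a *: p) = `|a| * prod_enorm p.
Proof. by rewrite /prod_enorm !enormZ mulrDr. Qed.

Fact prod_enorm_equiv : exists2 C : R, 0 < C &
  forall p, `|p| <= C * prod_enorm p /\ prod_enorm p <= C * `|p|.
Proof.
have [C C0 hC] := @enorm_equiv R E; have [D D0 hD] := @enorm_equiv R F.
exists (C + D); first exact: addr_gt0.
case=> x y; rewrite /prod_enorm/= prod_normE/=.
have [[x1 x2] [y1 y2]] := (hC x, hD y).
have x0 : 0 <= enorm x by rewrite -(pmulr_rge0 _ C0) (le_trans _ x1).
have y0 : 0 <= enorm y by rewrite -(pmulr_rge0 _ D0) (le_trans _ y1).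
split; first by rewrite ge_max; apply/andP; split; nra.
have mx : `|x| <= Num.max `|x| `|y| by rewrite le_max lexx.
have my : `|y| <= Num.max `|x| `|y| by rewrite le_max lexx orbT.
by nra.
Qed.

HB.instance Definition _ := NormedModule_isEuclidean.Build R (E * F)%type
  prod_innerC prod_innerDl prod_innerZl prod_inner_gt0
  prod_enormD prod_enormZ prod_enorm_equiv.

End products.

Definition minkowski_sum (V : nmodType) (A B : set V) : set V :=
  [set a + b | a in A & b in B].

Notation "A \oplus B" := (minkowski_sum A B)
  (at level 50, left associativity) : classical_set_scope.

Definition locally_closed (T : topologicalType) (A : set T) : Prop :=
  forall x, A x -> exists U, [/\ nbhs x U, closed U & closed (A `&` U)].

Section variational_analysis.
Context {R : realType}.
Implicit Types E F : euclideanType R.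

(* The library's Lipschitz condition is for the max norm of R^n; by            *)
(* equivalence of norms this does not affect local Lipschitz continuity.       *)
Definition locally_lipschitz E (f : E -> R^o) : Prop :=
  forall x : E, exists2 U, nbhs x U & [lipschitz f y | y in U].

Definition dist E (z : E) (A : set E) : \bar R :=
  ereal_inf [set (enorm (a - z))%:E | a in A].

Definition graph E F (Y : E -> set F) : set (E * F) := [set p | Y p.1 p.2].

Definition dom E F (Y : E -> set F) : set E := [set z | Y z !=set0].

Definition inverse_map E F (Y : E -> set F) (w : F) : set E := [set z | Y z w].

Definition metrically_subregular E F (Y : E -> set F) (z : E) (w : F) : Prop :=
  graph Y (z, w) /\
  exists2 kappa : R, 0 < kappa &
    \forall x \near z, (dist x (inverse_map Y w) <= kappa%:E * dist w (Y x))%E.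

Definition inner_semicompact E F (Y : E -> set F) (z : E) (Omega : set E)
    : Prop :=
  dom Y z /\
  forall u : nat -> E, (forall k, Omega (u k)) -> u @ \oo --> z ->
    exists (phi : nat -> nat) (v : nat -> F) (w : F),
      [/\ {homo phi : i j / (i < j)%N},
          v @ \oo --> w &
          forall l, Y (u (phi l)) (v l)].

Definition tangent_cone E (A : set E) (z : E) : set E :=
  [set d | exists (t : nat -> R) (e : nat -> E),
    [/\ forall k, 0 < t k,
        t @ \oo --> 0,
        e @ \oo --> d &
        forall k, A (z + t k *: e k)]].

Definition polar E (A : set E) : set E :=
  [set xi | forall d, A d -> inner xi d <= 0].

Definition regular_normal_cone E (A : set E) (z : E) : set E :=
  polar (tangent_cone A z).

Definition limiting_normal_cone E (A : set E) (z : E) : set E :=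
  [set xi | exists (u : nat -> E) (eta : nat -> E),
    [/\ forall k, A (u k),
        u @ \oo --> z,
        forall k, regular_normal_cone A (u k) (eta k) &
        eta @ \oo --> xi]].

Definition epigraph E (f : E -> R^o) : set (E * R^o) :=
  [set p | f p.1 <= p.2].

Definition limiting_subdifferential E (f : E -> R^o) (z : E) : set E :=
  [set xi | limiting_normal_cone (epigraph f) (z, f z) (xi, -1)].

Definition coderivative E F (Y : E -> set F) (z : E) (w eta : F) : set E :=
  [set xi | limiting_normal_cone (graph Y) (z, w) (xi, - eta)].

End variational_analysis.

Section problem.
Context {R : realType} {n m s : nat}.
Variables (f : 'rV[R]_n -> R^o) (F : 'rV[R]_n -> set 'rV[R]_m).
Variables (G : 'rV[R]_n * 'rV[R]_m -> set 'rV[R]_s) (M : set 'rV[R]_n).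

Definition Hmap (z : 'rV[R]_n) : set 'rV[R]_s :=
  \bigcup_(lam in F z) G (z, lam).

Definition Kmap (z : 'rV[R]_n) : set 'rV[R]_m :=
  [set lam | F z lam /\ G (z, lam) 0].

Definition Khatmap (p : 'rV[R]_n * 'rV[R]_s) : set 'rV[R]_m :=
  [set lam | F p.1 lam /\ G (p.1, lam) p.2].

Definition calH (p : 'rV[R]_n * 'rV[R]_m) : set ('rV[R]_m * 'rV[R]_s) :=
  [set y - p.2 | y in F p.1] `*` G p.

(* (z, w, lam) is a left-nested triple. *)
Definition calHhat (p : 'rV[R]_n * 'rV[R]_s * 'rV[R]_m)
    : set ('rV[R]_m * 'rV[R]_s) :=
  let: (z, w, lam) := p in
  [set y - lam | y in F z] `*` [set v - w | v in G (z, lam)].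

Definition feasible (z : 'rV[R]_n) : Prop := Hmap z 0 /\ M z.

Definition implicitly_M_stationary (z : 'rV[R]_n) : Prop :=
  feasible z /\
  exists nu : 'rV[R]_s,
    (limiting_subdifferential f z
     \oplus coderivative Hmap z 0 nu
     \oplus limiting_normal_cone M z) 0.

Definition fuzzily_M_stationary (z : 'rV[R]_n) : Prop :=
  feasible z /\
  exists (lam mu : 'rV[R]_m) (nu : 'rV[R]_s),
    Kmap z lam /\
    ((limiting_subdifferential f z `*` [set 0])
     \oplus coderivative calH (z, lam) (0, 0) (mu, nu)
     \oplus (limiting_normal_cone M z `*` [set 0])) (0, 0).

Definition explicitly_M_stationary (z : 'rV[R]_n) : Prop :=
  feasible z /\
  exists (lam mu : 'rV[R]_m) (nu : 'rV[R]_s),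
    Kmap z lam /\
    (limiting_subdifferential f z
     \oplus coderivative F z lam mu
     \oplus [set xi | coderivative G (z, lam) 0 nu (xi, mu)]
     \oplus limiting_normal_cone M z) 0.

End problem.

(* Main.v *)
(** Let [(xi_k, - nu_k)] be regular normals to [gph H] at [(z_k, w_k)] tending to
    [(xi, - nu)].  Semicompactness provides [lam_k] in [Khat (z_k, w_k)] tending
    to some [lam].  For [((z', lam'), (a, v))] in [gph calH] the point
    [(z', v, lam')] makes the second factor of [calHhat] contain [0], so that
    subregularity bounds its distance to [gph Khat] by [kappa * |a|].  As
    [gph Khat] projects onto [gph H], the linear form
    [d |-> <xi_k, dz> - <nu_k, dv>] is therefore at most
    [o(|(dz, dv)|) + c * |a|] on [gph calH] near [((z_k, lam_k), (0, w_k))], with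
    [c] independent of [k].  Subtracting from the form a quadratic penalty that
    weighs [a] much more than the other components and maximizing over
    [gph calH], one finds, arbitrarily close to this point, regular normals
    close to [((xi_k, 0), (- mu_k, - nu_k))] with [mu_k] bounded; a limit [mu] of
    the [mu_k] is the required multiplier. *)

Require Import Defs.
From HB Require Import structures.
From mathcomp Require Import all_boot all_order all_algebra.
From mathcomp Require Import all_classical all_reals all_analysis.
From mathcomp Require Import lra.

Import Order.TTheory GRing.Theory Num.Theory.
Import numFieldNormedType.Exports.

Local Open Scope classical_set_scope.
Local Open Scope ring_scope.

(** * Convergence of sequences and extraction of subsequences *)

Section sequences.
Context {R : realType} {E : normedModType R}.
Implicit Types (u v : nat -> E) (x : E).

Lemma cvg_natSinv u x :
  (forall k, `|u k - x| < k.+1%:R^-1) -> u @ \oo --> x.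
Proof.
move=> ux; apply/cvgrPdist_lt => e e0.
near=> k; rewrite distrC; apply: (lt_trans (ux k)).
near: k; exact: (near_infty_natSinv_lt (PosNum e0)).
Unshelve. all: by end_near. Qed.

Lemma cvg_subseq u x (phi : nat -> nat) :
  (forall l, (l <= phi l)%N) -> u @ \oo --> x -> u (phi l) @[l --> \oo] --> x.
Proof.
move=> phi_ge /cvgrPdist_lt ux; apply/cvgrPdist_lt => e /ux[N _ hN].
by exists N => // l /= Nl; apply: hN => /=; apply: leq_trans Nl _.
Qed.

(** Each index [l] selects a term of index at least [l] within [l.+1%:R^-1] of a cluster point. The
    resulting [phi] need not be increasing: [l <= phi l] is all that [cvg_subseq] requires. *)
Lemma compact_subseq u (K : set E) : compact K -> (forall k, K (u k)) ->
  exists (phi : nat -> nat) x, [/\ forall l, (l <= phi l)%N, K x &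
    u (phi l) @[l --> \oo] --> x].
Proof.
move=> cK uK; have [|x [Kx clx]] := cK (u @ \oo) _.
  by exists 0%N => // k _; exact: uK.
have step l : exists j, (l <= j)%N /\ `|u j - x| < l.+1%:R^-1.
  have [||y [[j lj <-] yx]] := clx [set u j | j in [set j | (l <= j)%N]]
      [set y | `|x - y| < l.+1%:R^-1].
  - by exists l => // j /= lj; exists j.
  - by apply/nbhs_normP; exists l.+1%:R^-1 => //=.
  by exists j; rewrite distrC.
have [phi phiP] := choice step.
exists phi, x; split=> //; first by move=> l; case: (phiP l).
by apply: cvg_natSinv => l; case: (phiP l).
Qed.

End sequences.

(** * Inner products: Cauchy-Schwarz, equivalence of norms and compact balls *)

Section inner_product.
Context {R : realType} {E : euclideanType R}.
Implicit Types (x y z : E) (a : R).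

Lemma innerDr x y z : inner x (y + z) = inner x y + inner x z :> R.
Proof. by rewrite !(innerC x) innerDl. Qed.

Lemma innerZr a x y : inner x (a *: y) = a * inner x y.
Proof. by rewrite !(innerC x) innerZl. Qed.

Lemma innerNl x y : inner (- x) y = - inner x y :> R.
Proof. by rewrite -scaleN1r innerZl mulN1r. Qed.

Lemma innerNr x y : inner x (- y) = - inner x y :> R.
Proof. by rewrite innerC innerNl innerC. Qed.

Lemma innerBl x y z : inner (x - y) z = inner x z - inner y z :> R.
Proof. by rewrite innerDl innerNl. Qed.

Lemma innerBr x y z : inner x (y - z) = inner x y - inner x z :> R.
Proof. by rewrite innerDr innerNr. Qed.

Lemma inner0l x : inner 0 x = 0 :> R.
Proof. by rewrite -(scale0r (0 : E)) innerZl mul0r. Qed.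

Lemma inner0r x : inner x 0 = 0 :> R.
Proof. by rewrite innerC inner0l. Qed.

Lemma inner_ge0 x : 0 <= inner x x :> R.
Proof.
by have [->|/inner_gt0/ltW//] := eqVneq x 0; rewrite inner0l.
Qed.

(** The norm induced by [inner]. On products it differs from [enorm]; the penalization relies on it
    because orthogonal projections obey the Pythagorean identity for this norm. *)
Definition inorm x : R := Num.sqrt (inner x x).

Lemma inorm_ge0 x : 0 <= inorm x. Proof. exact: sqrtr_ge0. Qed.

Lemma sqr_inorm x : inorm x ^+ 2 = inner x x.
Proof. by rewrite sqr_sqrtr// inner_ge0. Qed.

Lemma inormZ a x : inorm (a *: x) = `|a| * inorm x.
Proof.
by rewrite /inorm innerZl innerZr mulrA -expr2 sqrtrM ?sqr_ge0// sqrtr_sqr.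
Qed.

Lemma inormN x : inorm (- x) = inorm x.
Proof. by rewrite -scaleN1r inormZ normrN1 mul1r. Qed.

Lemma cauchy_schwarz x y : inner x y <= inorm x * inorm y.
Proof.
have [->|y0] := eqVneq y 0; first by rewrite inner0r mulr_ge0 ?inorm_ge0.
have yy : 0 < inner y y :> R by exact: inner_gt0.
have := inner_ge0 (inner y y *: x - inner x y *: y).
rewrite innerBl !innerBr !(innerZl, innerZr) (innerC y x) -!sqr_inorm.
have : 0 < inorm y by rewrite sqrtr_gt0.
have := inorm_ge0 x.
set p := inner x y; set b := inorm y; set a := inorm x => a0 b0 h.
have {}h : p ^+ 2 <= (a * b) ^+ 2.
  rewrite -(@ler_pM2l _ (b ^+ 2)) ?exprn_gt0//; move: h; lra.
have [p0|p0] := ltP p 0; first by apply/(le_trans (ltW p0))/mulr_ge0 => //; lra.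
by rewrite -(@ler_pXn2r _ 2)// nnegrE mulr_ge0// ltW.
Qed.

Lemma normr_inner_le x y : `|inner x y| <= inorm x * inorm y.
Proof.
by rewrite ler_norml lerNl -innerNl -{1}(inormN x) !cauchy_schwarz.
Qed.

End inner_product.

(* On an abstract [euclideanType] the inner product need not be continuous. *)
Definition finite_dimensional {R : realType} (E : euclideanType R) : Prop :=
  (exists2 C : R, 0 < C &
    forall x : E, `|x| <= C * inorm x /\ inorm x <= C * `|x|) /\
  forall r : R, compact [set x : E | `|x| <= r].

Lemma finite_dimensional_rV (R : realType) (n : nat) :
  finite_dimensional 'rV[R]_n.
Proof.
split; first exact: rV_enorm_equiv.
move=> r; apply: bounded_closed_compact.
  exists r; split; first exact: num_real.
  by move=> M rM x /= xr; rewrite (le_trans xr) ?ltW.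
have -> : [set x : 'rV[R]_n | `|x| <= r] = Num.norm @^-1` [set y | y <= r].
  by [].
by apply: closed_comp; [move=> x _; exact: norm_continuous|exact: closed_le].
Qed.

Lemma finite_dimensional_prod (R : realType) (E F : euclideanType R) :
  finite_dimensional E -> finite_dimensional F ->
  finite_dimensional (E * F)%type.
Proof.
move=> [[C C0 hC] cE] [[D D0 hD] cF]; split; last first.
  move=> r; rewrite (_ : mkset _ =
      [set x : E | `|x| <= r] `*` [set y : F | `|y| <= r]); last first.
    by apply/seteqP; split=> [] [x y] /=; rewrite prod_normE/= ge_max => /andP.
  exact: compact_setX.
exists (C + D); first exact: addr_gt0.
move=> [x y]; rewrite prod_normE /=.
have [[x1 x2] [y1 y2]] := (hC x, hD y).
have sqE : inorm (x, y) ^+ 2 = inorm x ^+ 2 + inorm y ^+ 2.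
  by rewrite !sqr_inorm.
have [i0 [ix0 iy0]] := (inorm_ge0 (x, y), (inorm_ge0 x, inorm_ge0 y)).
have ix : inorm x <= inorm (x, y).
  by rewrite -(@ler_pXn2r _ 2)// ?nnegrE// sqE lerDl sqr_ge0.
have iy : inorm y <= inorm (x, y).
  by rewrite -(@ler_pXn2r _ 2)// ?nnegrE// sqE lerDr sqr_ge0.
have ixy : inorm (x, y) <= inorm x + inorm y.
  rewrite -(@ler_pXn2r _ 2)// ?nnegrE ?addr_ge0// sqE; nra.
split; first by rewrite ge_max; apply/andP; split; nra.
have mx : `|x| <= Num.max `|x| `|y| by rewrite le_max lexx.
have my : `|y| <= Num.max `|x| `|y| by rewrite le_max lexx orbT.
by nra.
Qed.

(** * Regular and limiting normals in finite dimension *)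

Section finite_dimension.
Context {R : realType} {E : euclideanType R}.
Hypothesis fdE : finite_dimensional E.
Implicit Types (A : set E) (x y z : E).

Lemma normr_inner_le_norm :
  exists2 C : R, 0 < C & forall x y, `|inner x y| <= C * (`|x| * `|y|).
Proof.
case: fdE => -[C C0 hC] _; exists (C * C); first exact: mulr_gt0.
move=> x y; apply: (le_trans (normr_inner_le x y)).
by rewrite mulrACA ler_pM ?inorm_ge0//; [case: (hC x)|case: (hC y)].
Qed.

Lemma cvg_inner T (F : set_system T) {FF : Filter F} (u v : T -> E) x y :
  u @ F --> x -> v @ F --> y ->
  (inner (u t) (v t) : R) @[t --> F] --> (inner x y : R).
Proof.
have [C C0 hC] := normr_inner_le_norm => ux vy.
pose b t := C * (`|u t - x| * `|v t|) + C * (`|x| * `|v t - y|).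
have b0 : b t @[t --> F] --> (0 : R).
  rewrite (_ : 0 = C * (`|x - x| * `|y|) + C * (`|x| * `|y - y|)).
    by apply: cvgD; apply: cvgMl_tmp; apply: cvgM; apply: cvg_norm => //;
      try apply: cvgB => //; apply: cvg_cst.
  by rewrite !subrr !normr0 mul0r !mulr0 addr0.
apply/subr_cvg0; apply: norm_cvg0.
suff le_b : \forall t \near F,
    cst 0 t <= `|inner (u t) (v t) - inner x y| <= b t.
  exact: (squeeze_cvgr le_b (cvg_cst (0 : R)) b0).
apply: nearW => t /=; rewrite normr_ge0 /=.
have -> : inner (u t) (v t) - inner x y =
    inner (u t - x) (v t) + inner x (v t - y) :> R.
  by rewrite innerBl innerBr addrA subrK.
by apply: (le_trans (ler_normD _ _)); apply: lerD; exact: hC.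
Qed.

Lemma cvg_innerr T (F : set_system T) {FF : Filter F} (v : T -> E) x y :
  v @ F --> y -> (inner x (v t) : R) @[t --> F] --> (inner x y : R).
Proof. by move=> vy; apply: cvg_inner vy; exact: cvg_cst. Qed.

(** This passes from the polar of the tangent cone to the first-order estimate. If the estimate
    failed along points tending to [z], compactness of the unit ball would make their normalized
    differences subconverge to a tangent [d] with [inner xi d >= e], against polarity. *)
Lemma regular_normal_le A z xi (e : R) : regular_normal_cone A z xi -> 0 < e ->
  \forall x \near z, A x -> inner xi (x - z) <= e * `|x - z|.
Proof.
move=> Nxi e0; apply: contrapT => /nbhs_normP nn.
have step k : exists x, [/\ `|x - z| < k.+1%:R^-1, A x &
    e * `|x - z| < inner xi (x - z)].
  apply: contrapT => nx; apply: nn; exists k.+1%:R^-1 => //= x zx Ax.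
  rewrite leNgt; apply/negP => lt; apply: nx.
  by exists x; split=> //; rewrite distrC.
have [u uP] := choice step.
have uz : u @ \oo --> z by apply: cvg_natSinv => k; case: (uP k).
have pos k : 0 < `|u k - z|.
  rewrite normr_gt0; apply/eqP => uz0.
  by case: (uP k) => _ _; rewrite uz0 normr0 mulr0 inner0r ltxx.
case: fdE => _ /(_ 1) cB.
have [|phi [d [phi_ge _ ed]]] :=
    @compact_subseq _ _ (fun k => `|u k - z|^-1 *: (u k - z)) _ cB.
  by move=> k /=; rewrite normrZ normfV normr_id mulVf// gt_eqF.
have Td : tangent_cone A z d.
  exists (fun l => `|u (phi l) - z|), (fun l =>
      `|u (phi l) - z|^-1 *: (u (phi l) - z)); split=> //.
    have /norm_cvg0P : u (phi l) - z @[l --> \oo] --> (0 : E).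
      by apply/subr_cvg0; exact: cvg_subseq.
    by apply.
  move=> k; rewrite scalerA divff ?gt_eqF// scale1r addrC subrK.
  by case: (uP (phi k)).
have := Nxi _ Td; apply/negP; rewrite -ltNge; apply: (lt_le_trans e0).
have ixi : (inner xi (`|u (phi l) - z|^-1 *: (u (phi l) - z)) : R)
    @[l --> \oo] --> (inner xi d : R) by exact: cvg_innerr.
have ce : (fun=> e) k @[k --> \oo] --> e by exact: cvg_cst.
apply: (ler_cvg_to ce ixi).
apply: nearW => l; rewrite innerZr mulrC ler_pdivlMr//.
by case: (uP (phi l)) => _ _ /ltW.
Qed.

(** Along [z + t k *: e k], dividing the bound by [t k] leaves a right-hand side of order [t k],
    which vanishes in the limit. *)
Lemma proximal_normal A z xi (K : R) :
  (\forall x \near z, A x -> inner xi (x - z) <= K * `|x - z| ^+ 2) ->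
  regular_normal_cone A z xi.
Proof.
move=> nK d [t [e [t0 tc ed Ate]]].
have tez : z + t k *: e k @[k --> \oo] --> z.
  rewrite -[X in _ --> X]addr0 -(scale0r d).
  by apply: cvgD; [exact: cvg_cst|exact: cvgZ].
have lim0 : K * (t k * (`|e k| * `|e k|)) @[k --> \oo] --> (0 : R).
  rewrite -[X in _ --> X](mulr0 K) -(mul0r (`|d| * `|d|)).
  apply: cvgMl_tmp; apply: cvgM => //.
  by apply: cvgM; exact: cvg_norm.
have limi : (inner xi (e k) : R) @[k --> \oo] --> (inner xi d : R).
  exact: cvg_innerr.
apply: (ler_cvg_to limi lim0); near=> k.
have : inner xi (z + t k *: e k - z) <= K * `|z + t k *: e k - z| ^+ 2.
  by move: (Ate k); near: k; exact: (tez _ nK).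
rewrite (addrC z) addrK innerZr normrZ (gtr0_norm (t0 k)) -expr2 => h.
by rewrite -(ler_pM2l (t0 k)); move: h; lra.
Unshelve. all: by end_near. Qed.

Lemma limiting_normal_approx A z xi :
  (forall e : R, 0 < e -> exists x eta, [/\ A x, `|x - z| < e,
    regular_normal_cone A x eta & `|eta - xi| < e]) ->
  limiting_normal_cone A z xi.
Proof.
move=> h; have /choice[u /choice[eta uP]] : forall k, exists x, exists eta,
    [/\ A x, `|x - z| < k.+1%:R^-1, regular_normal_cone A x eta &
        `|eta - xi| < k.+1%:R^-1].
  by move=> k; apply: h.
exists u, eta; split.
- by move=> k; case: (uP k).
- by apply: cvg_natSinv => k; case: (uP k).
- by move=> k; case: (uP k).
- by apply: cvg_natSinv => k; case: (uP k).
Qed.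

End finite_dimension.

(** Here [a] and [b] stand for the norms of the components of a displacement off and along the range
    of a projection. In terms of [r] and [t], the norms of the two parts of the penalty gradient,
    the hypothesis reads [r ^+ 2 + delta ^+ 2 * t ^+ 2 <= 2 * delta ^+ 2 * (r + c * t)]. Completing
    the square in [t] bounds [r], and completing it in [r] bounds [t]. *)
Lemma penalty_bounds {R : realType} (delta N c a b : R) :
  0 < delta <= 1 -> 0 < N -> 0 <= c -> 0 <= a -> 0 <= b ->
  (delta ^+ 2 * N) * a ^+ 2 + N * b ^+ 2 <= 2 * (delta ^+ 2 * a + c * b) ->
  delta ^+ 2 * N * a <= delta * (c + 2) /\ N * b <= 2 * c + 1.
Proof.
move=> /andP[d0 d1] N0 c0 a0 b0 h.
pose r := delta ^+ 2 * N * a; pose t := N * b.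
have d20 : 0 < delta ^+ 2 by rewrite exprn_gt0.
have r0 : 0 <= r by rewrite /r !mulr_ge0// ltW.
have t0 : 0 <= t by rewrite /t mulr_ge0// ltW.
have {}h : r ^+ 2 + delta ^+ 2 * t ^+ 2 <= 2 * delta ^+ 2 * (r + c * t).
  have := ler_wpM2l (ltW (mulr_gt0 d20 N0)) h; rewrite /r /t; lra.
rewrite -/r -/t; split; rewrite leNgt; apply/negP => lt.
  have rt : r ^+ 2 - 2 * delta ^+ 2 * r <= delta ^+ 2 * c ^+ 2.
    have := mulr_ge0 (ltW d20) (sqr_ge0 (t - c)); lra.
  have r1 : delta * (c + 2) * (r - 2 * delta ^+ 2) <= r * (r - 2 * delta ^+ 2).
    by apply: ler_wpM2r; [nra|exact: ltW].
  have r2 : delta * c < r - 2 * delta ^+ 2 by nra.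
  have : delta * (c + 2) * (delta * c) <=
      delta * (c + 2) * (r - 2 * delta ^+ 2).
    by apply: ler_wpM2l; [rewrite mulr_ge0; lra|exact: ltW].
  have : 0 < (r - 2 * delta ^+ 2) * delta by rewrite mulr_gt0//; nra.
  nra.
have tt : delta ^+ 2 * (t ^+ 2 - 2 * c * t) <= delta ^+ 2 * delta ^+ 2.
  have := sqr_ge0 (r - delta ^+ 2); lra.
rewrite ler_pM2l// in tt.
have : delta ^+ 2 <= 1 by rewrite expr_le1// ltW.
nra.
Qed.

(** * Quadratic penalization relative to an orthogonal projection [P] *)

Section penalization.
Context {R : realType} {E : euclideanType R}.
Hypothesis fdE : finite_dimensional E.
Variable P : E -> E.
Hypothesis P_linear : linear P.
Hypothesis P_sym : forall x y, inner (P x) y = inner x (P y) :> R.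
Hypothesis P_idem : forall x, P (P x) = P x.

Let PD x y : P (x + y) = P x + P y.
Proof. by have := P_linear 1 x y; rewrite !scale1r. Qed.

Let P0 : P 0 = 0.
Proof. by apply: (addrI (P 0)); rewrite -PD !addr0. Qed.

Let PN x : P (- x) = - P x.
Proof.
by apply: (addrI (P x)); rewrite -PD !subrr.
Qed.

Let inorm_P x : inorm (P x) <= inorm x.
Proof.
have [Px0|Px0] := leP (inorm (P x)) 0; first exact: le_trans (inorm_ge0 x).
rewrite -(ler_pM2r Px0) -expr2 sqr_inorm P_sym P_idem.
exact: cauchy_schwarz.
Qed.

Let continuous_P : continuous P.
Proof.
case: fdE => -[C C0 hC] _ x; apply/subr_cvg0; apply: norm_cvg0.
suff le_b : \forall y \near x, cst 0 y <= `|P y - P x| <= C * C * `|y - x|.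
  apply: (squeeze_cvgr le_b (cvg_cst (0 : R))).
  rewrite -[X in _ --> X](mulr0 (C * C)); apply: cvgMl_tmp.
  by apply/norm_cvg0P/subr_cvg0; exact: cvg_id.
apply: nearW => y /=; rewrite normr_ge0 -PN -PD /=.
have [le1 _] := hC (P (y - x)); apply: (le_trans le1).
rewrite -mulrA ler_pM2l//; apply: (le_trans (inorm_P _)).
by case: (hC (y - x)).
Qed.

Let inner_compl x : inner x (x - P x) = inorm (x - P x) ^+ 2 :> R.
Proof.
rewrite sqr_inorm !innerBl !innerBr -(P_sym x).
rewrite [X in _ = _ - X](_ : _ = 0) ?subr0//.
by rewrite (P_sym x (P x)) P_idem P_sym subrr.
Qed.

Let inner_P x : inner x (P x) = inorm (P x) ^+ 2 :> R.
Proof. by rewrite sqr_inorm P_sym P_idem. Qed.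

(* The estimate says that [p0] almost minimizes over [A] the function
   [c * inorm (P d) - inner xi d] of [d := p - p0].  Penalizing quadratically,
   with a much larger weight along the range of [P], gives nearby minimizers
   at which [A] has proximal normals. *)
Lemma penalized_normal (A : set E) p0 xi (c delta : R) :
  closed A -> A p0 -> 0 <= c -> 0 < delta <= 1 ->
  (\forall p \near p0, A p -> inner xi (p - p0) <=
    delta ^+ 2 * inorm (p - p0 - P (p - p0)) + c * inorm (P (p - p0))) ->
  exists p eta y, [/\ A p /\ `|p - p0| < delta, regular_normal_cone A p eta,
    P y = y, inorm y <= 2 * c + 1 & inorm (xi - y - eta) <= delta * (c + 2)].
Proof.
move=> cA Ap0 c0 /andP[d0 d1] /nbhs_normP[rho rho0 hA].
have {}rho0 : 0 < rho := rho0.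
have [[C C0 hC] cball] := fdE.
(* A minimizer within [e] of [p0] is interior to the ball of radius [rho / 2] that cuts out [K], and
   closer than [delta] to [p0]. *)
pose e := Num.min (rho / 2) delta.
have e0 : 0 < e by rewrite lt_min d0 divr_gt0.
(* For a minimizer [p], [penalty_bounds] yields [N * |p - p0| <= L]; the choice of [N] below makes
   this smaller than [N * e]. *)
pose L := C * (delta * (c + 2) / delta ^+ 2 + (2 * c + 1)).
have L0 : 0 <= L.
  by rewrite /L; apply: mulr_ge0; [exact: ltW|];
    rewrite addr_ge0 ?divr_ge0 ?mulr_ge0 ?exprn_ge0//; lra.
pose N := L / e + 1.
have N0 : 0 < N by rewrite /N ltr_wpDl// divr_ge0// ltW.
have LN : L < e * N by rewrite /N mulrDr mulr1 mulrC divfK ?gt_eqF// ltrDl.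
(* [B] is self-adjoint, so the gradient of [g] at [p] is [B (p - p0) - xi]. *)
pose B d := (delta ^+ 2 * N) *: (d - P d) + N *: P d.
pose g p := inner (p - p0) (B (p - p0)) / 2 - inner xi (p - p0).
have gE p : g p = (delta ^+ 2 * N * inorm (p - p0 - P (p - p0)) ^+ 2
    + N * inorm (P (p - p0)) ^+ 2) / 2 - inner xi (p - p0).
  by rewrite /g /B innerDr !innerZr inner_compl inner_P.
pose K := A `&` [set p | `|p - p0| <= rho / 2].
have shift_cont : continuous (fun p : E => p - p0).
  by move=> p; apply: cvgB; [exact: cvg_id|exact: cvg_cst].
have cK : compact K.
  rewrite /K setIC; apply: compact_closedI => //.
  rewrite (_ : mkset _ = (fun q => q + p0) @` [set q | `|q| <= rho / 2]).
    apply: continuous_compact (cball _); apply: continuous_subspaceT => q.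
    by apply: cvgD; [exact: cvg_id|exact: cvg_cst].
  apply/seteqP; split=> [p pp|_ [q qq <-]] /=; last by rewrite addrK.
  by exists (p - p0) => //; rewrite subrK.
have gc : {within K, continuous g}.
  apply: continuous_subspaceT => p; rewrite /g.
  have sp := shift_cont p.
  have Psp : P (q - p0) @[q --> p] --> P (p - p0).
    by apply: cvg_comp sp _; exact: continuous_P.
  apply: cvgB; last exact: cvg_innerr.
  apply: cvgMr_tmp; apply: cvg_inner => //; rewrite /B.
  by apply: cvgD; apply: cvgZl_tmp => //; apply: cvgB.
have Kp0 : K p0 by split=> //=; rewrite subrr normr0 divr_ge0// ltW.
have [|p pK gmin] := compact_EVT_min _ cK gc; first by exists p0.
rewrite inE in pK; have [Ap /= pp0] := pK.
pose d := p - p0.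
have [bnd1 bnd2] : delta ^+ 2 * N * inorm (d - P d) <= delta * (c + 2) /\
    N * inorm (P d) <= 2 * c + 1.
  apply: penalty_bounds; rewrite ?d0 ?inorm_ge0//.
  (* Minimality gives [g p <= g p0 = 0], and [hA] bounds the linear term of [g p] from above. *)
  have := gmin p0; rewrite inE !gE subrr inner0r => /(_ Kp0).
  have i0 : inorm (0 : E) = 0 by rewrite /inorm inner0r sqrtr0.
  rewrite !(P0, subr0, i0, expr0n, mulr0, addr0, mul0r)/= -/d => gp.
  have := hA p; rewrite /ball_/= distrC -/d.
  by rewrite (le_lt_trans pp0) => [/(_ isT Ap)|]; move: gp; lra.
have dlt : `|d| < e.
  rewrite -(ltr_pM2r N0); apply: le_lt_trans LN.
  have [nd1 _] := hC (d - P d); have [nd2 _] := hC (P d).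
  have nd : `|d| <= C * (inorm (d - P d) + inorm (P d)).
    have := ler_normD (d - P d) (P d); rewrite subrK; lra.
  have bnd1' : N * inorm (d - P d) <= delta * (c + 2) / delta ^+ 2.
    by rewrite ler_pdivlMr ?exprn_gt0// mulrC mulrA.
  apply: (le_trans (ler_wpM2r (ltW N0) nd)).
  rewrite -[leLHS]mulrA /L ler_pM2l// mulrDl; apply: lerD; rewrite mulrC//.
have BD x y : B (x + y) = B x + B y.
  by rewrite /B PD opprD addrACA !scalerDr addrACA.
have B_sym x y : inner x (B y) = inner y (B x) :> R.
  rewrite /B !innerDr !innerZr !innerBr -(P_sym x) (innerC (P x)).
  by rewrite (innerC x y).
have B_le x : inner x (B x) <= (delta ^+ 2 * N + N) * C ^+ 2 * `|x| ^+ 2.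
  have pyth : inorm x ^+ 2 = inorm (x - P x) ^+ 2 + inorm (P x) ^+ 2.
    by rewrite -inner_compl -inner_P -innerDr subrK sqr_inorm.
  have xC : inorm x ^+ 2 <= C ^+ 2 * `|x| ^+ 2.
    rewrite -exprMn lerXn2r ?nnegrE ?inorm_ge0 ?mulr_ge0 ?(ltW C0)//.
    by case: (hC x).
  rewrite /B innerDr !innerZr inner_compl inner_P.
  have d20 : 0 < delta ^+ 2 * N by rewrite mulr_gt0 ?exprn_gt0.
  have := sqr_ge0 (inorm (x - P x)); have := sqr_ge0 (inorm (P x)).
  move=> ? ?; rewrite -[leRHS]mulrA.
  apply: (@le_trans _ _ ((delta ^+ 2 * N + N) * inorm x ^+ 2)).
    by rewrite pyth; nra.
  by rewrite ler_pM2l// addr_gt0.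
(* The normal is minus the gradient of [g] at [p]. The part of [B d] in the range of [P] is the
   multiplier, merely bounded; the complementary part is the error of order [delta]. *)
exists p, (xi - B d), (N *: P d); split.
- by split => //; apply: lt_le_trans dlt _; rewrite ge_min lexx orbT.
- apply: (proximal_normal fdE _ _ _
    ((delta ^+ 2 * N + N) * C ^+ 2 / 2)).
  (* The quadratic [g] equals its second-order expansion at [p], so minimality bounds
     [inner (xi - B d) (x - p)] by half of [inner (x - p) (B (x - p))]. The radius keeps [x] in
     [K]. *)
  apply/nbhs_normP; exists (e - `|d|) => /=; first by rewrite subr_gt0.
  move=> x; rewrite /ball_/= distrC => px Ax; have := gmin x; rewrite inE.
  have -> : g x = g p + (inner (x - p) (B d) + inner (x - p) (B (x - p)) / 2
      - inner xi (x - p)).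
    rewrite /g -/d (_ : x - p0 = d + (x - p)); last first.
      by rewrite /d [RHS]addrC addrA subrK.
    rewrite BD !(innerDl d) !(innerDr _ (B d)) (innerDr xi d).
    rewrite (B_sym d (x - p)); lra.
  have e_rho : e <= rho / 2 by rewrite ge_min lexx.
  have Kx : K x.
    split=> //=; have := ler_normD (x - p) d.
    by rewrite /d addrA subrK -/d; move: px; lra.
  move=> /(_ Kx); have := B_le (x - p).
  by rewrite (innerBl xi) (innerC (B d)); lra.
- by have := P_linear N (P d) 0; rewrite P0 !addr0 P_idem.
- by rewrite inormZ gtr0_norm.
- rewrite (_ : _ - _ = (delta ^+ 2 * N) *: (d - P d)); last first.
    by rewrite opprB (addrC (B d)) addrA (addrAC xi) subrr add0r addrC /B addrK.
  by rewrite inormZ gtr0_norm// mulr_gt0// exprn_gt0.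
Qed.
(** Since [c] is fixed before [e], the multipliers given by [penalized_normal] stay in one compact
    ball, and [y] is the limit of a subsequence of them. It remains in the range of [P] by
    continuity. *)
Lemma limiting_normal_penalized (A : set E) p0 xi (c : R) :
  closed A -> 0 <= c ->
  (forall e : R, 0 < e -> exists q zeta,
    [/\ A q, `|q - p0| < e, `|zeta - xi| < e &
      \forall p \near q, A p -> inner zeta (p - q) <=
        e * inorm (p - q - P (p - q)) + c * inorm (P (p - q))]) ->
  exists2 y, P y = y & limiting_normal_cone A p0 (xi - y).
Proof.
move=> cA c0 h; have [[C C0 hC] cball] := fdE.
have step (e : R) : 0 < e -> exists p eta y, [/\ A p /\ `|p - p0| < e,
    regular_normal_cone A p eta, P y = y, `|y| <= C * (2 * c + 1) &
    `|eta - (xi - y)| < e].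
  move=> e0; have C2 : 0 < C * (c + 2) by rewrite mulr_gt0//; lra.
  (* The last entry makes the error [delta * (c + 2)] at most [e / 2] after passing from [inorm] to
     the library norm. The hypothesis [h] is then used at a level below [delta ^+ 2], the
     coefficient that [penalized_normal] expects. *)
  pose delta := Num.min 1 (Num.min (e / 2) (e / 2 / (C * (c + 2)))).
  have delta0 : 0 < delta by rewrite !lt_min ltr01 !divr_gt0.
  have [d1 d2] : delta <= 1 /\ delta <= e / 2.
    by split; rewrite !ge_min lexx ?orbT.
  have d3 : delta * (C * (c + 2)) <= e / 2.
    by rewrite -ler_pdivlMr// !ge_min lexx !orbT.
  have d20 : 0 < delta ^+ 2 by rewrite exprn_gt0.
  have [|q [zeta [Aq qp0 zxi nq]]] := h (Num.min (delta ^+ 2) (e / 2)).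
    by rewrite lt_min d20 divr_gt0.
  rewrite !lt_min in qp0 zxi.
  case/andP: qp0 => _ qp0; case/andP: zxi => _ zxi.
  have [||p [eta [y [[Ap pq] Neta Py y_le eta_le]]]] :=
      @penalized_normal A q zeta c delta cA Aq c0.
  - by rewrite delta0.
  - apply: filterS nq => p hp Ap; apply: (le_trans (hp Ap)).
    by rewrite lerD2r ler_wpM2r ?inorm_ge0// ge_min lexx.
  exists p, eta, y; split=> //.
  - split=> //; have := ler_normD (p - q) (q - p0); rewrite addrA subrK; lra.
  - by have [ny _] := hC y; apply: (le_trans ny); rewrite ler_pM2l.
  - have [nz _] := hC (zeta - y - eta).
    have : C * inorm (zeta - y - eta) <= C * (delta * (c + 2)).
      by rewrite ler_pM2l.
    have := ler_normD (zeta - xi) (- (zeta - y - eta)).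
    rewrite normrN (_ : zeta - xi + _ = eta - (xi - y)); last first.
      rewrite opprB addrCA; congr (_ + _).
      by rewrite !opprB addrC addrA subrK.
    lra.
have /choice[p /choice[eta /choice[y hy]]] : forall k, exists p eta y,
    [/\ A p /\ `|p - p0| < k.+1%:R^-1, regular_normal_cone A p eta, P y = y,
      `|y| <= C * (2 * c + 1) & `|eta - (xi - y)| < k.+1%:R^-1].
  by move=> k; apply: step.
have [|phi [y0 [phi_ge _ yy0]]] := compact_subseq y _ (cball (C * (2 * c + 1))).
  by move=> k; case: (hy k).
exists y0.
  have Py : P (y (phi l)) @[l --> \oo] --> P y0.
    by apply: cvg_comp yy0 _; exact: continuous_P.
  have yE : (fun l => P (y (phi l))) = (fun l => y (phi l)).
    by apply/funext => l; case: (hy (phi l)).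
  by rewrite yE in Py; exact: (cvg_unique _ Py yy0).
apply: limiting_normal_approx => e e0.
have e20 : 0 < e / 2 by rewrite divr_gt0.
near \oo => l.
have yl : `|y0 - y (phi l)| < e / 2.
  by near: l; move/cvgrPdist_lt : yy0 => /(_ _ e20).
have le : (phi l).+1%:R^-1 < e / 2.
  apply: (@le_lt_trans _ _ l.+1%:R^-1).
    by rewrite lef_pV2 ?posrE// ler_nat ltnS.
  by near: l; exact: (near_infty_natSinv_lt (PosNum e20)).
have [[Ap pp0] Neta _ _ eta_lt] := hy (phi l).
exists (p (phi l)), (eta (phi l)); split=> //.
  have := lt_trans pp0 le; lra.
have {}eta_lt := lt_trans eta_lt le.
have := ler_normD (eta (phi l) - (xi - y (phi l))) (y0 - y (phi l)).
have -> : eta (phi l) - (xi - y (phi l)) + (y0 - y (phi l)) =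
    eta (phi l) - (xi - y0).
  rewrite !opprB -addrA; congr (_ + _).
  by rewrite addrC addrA subrK.
lra.
Unshelve. all: by end_near. Qed.

End penalization.

(** * The graph of [calH] and the consequences of subregularity of [calHhat] *)

Section calH_graph.
Context {R : realType} {n m s : nat}.
Variables (F : 'rV[R]_n -> set 'rV[R]_m).
Variables (G : 'rV[R]_n * 'rV[R]_m -> set 'rV[R]_s).

Local Notation T := (('rV[R]_n * 'rV[R]_m) * ('rV[R]_m * 'rV[R]_s))%type.

Lemma graph_calHP (p : T) :
  graph (calH F G) p <-> F p.1.1 (p.2.1 + p.1.2) /\ G p.1 p.2.2.
Proof.
case: p => -[z l] [a v]; rewrite /graph /calH /=; split=> -[].
  by move=> [y Fy /= <-] Gv; rewrite subrK.
by move=> Fa Gv; split=> //=; exists (a + l) => //; rewrite addrK.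
Qed.

Lemma closed_graph_calH :
  closed (graph F) -> closed (graph G) -> closed (graph (calH F G)).
Proof.
move=> cF cG.
have -> : graph (calH F G) =
    (fun p : T => (p.1.1, p.2.1 + p.1.2)) @^-1` graph F `&`
    (fun p : T => (p.1, p.2.2)) @^-1` graph G.
  by apply/seteqP; split=> p /=; [move/graph_calHP|move=> ?; apply/graph_calHP].
have c1 (p : T) : p.1 @[p --> p] --> p.1 by exact: cvg_fst.
have c2 (p : T) : p.2 @[p --> p] --> p.2 by exact: cvg_snd.
have c11 (p : T) : p.1.1 @[p --> p] --> p.1.1 by exact: cvg_comp (c1 p) cvg_fst.
have c12 (p : T) : p.1.2 @[p --> p] --> p.1.2 by exact: cvg_comp (c1 p) cvg_snd.
have c21 (p : T) : p.2.1 @[p --> p] --> p.2.1 by exact: cvg_comp (c2 p) cvg_fst.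
have c22 (p : T) : p.2.2 @[p --> p] --> p.2.2 by exact: cvg_comp (c2 p) cvg_snd.
apply: closedI; apply: closed_comp => // p _.
  apply: (@cvg_pair _ _ _ (nbhs p) (nbhs p.1.1) (nbhs (p.2.1 + p.1.2))).
    exact: c11.
  by apply: cvgD; [exact: c21|exact: c12].
apply: (@cvg_pair _ _ _ (nbhs p) (nbhs p.1) (nbhs p.2.2)).
  exact: c1.
exact: c22.
Qed.

(** The orthogonal projection onto the values in [F z - lam], used as [P] in the penalization. Its
    range is where the multiplier [mu] lives. *)
Definition slack_proj (p : T) : T := ((0, 0), (p.2.1, 0)).

Lemma slack_proj_linear : linear slack_proj.
Proof.
move=> a [[x1 x2] [x3 x4]] [[y1 y2] [y3 y4]].
by congr ((_, _), (_, _)); rewrite /= scaler0 addr0.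
Qed.

Lemma slack_proj_sym (p q : T) :
  inner (slack_proj p) q = inner p (slack_proj q) :> R.
Proof.
by rewrite /inner/= /prod_inner/= /inner/= /prod_inner/= !inner0l !inner0r.
Qed.

Lemma finite_dimensional_calH_space : finite_dimensional T.
Proof.
by do ?[apply: finite_dimensional_prod]; exact: finite_dimensional_rV.
Qed.

(* Since [x.1.2] itself lies in [G (x.1.1, x.2)], [calHhat x] contains
   [(a, 0)]. *)
Lemma dist_inverse_calHhat (z : 'rV[R]_n) (lam : 'rV[R]_m) :
  metrically_subregular (calHhat F G) (z, 0, lam) (0, 0) ->
  exists2 kappa : R, 0 < kappa & \forall x \near (z, 0 : 'rV[R]_s, lam),
    forall a, F x.1.1 (a + x.2) -> G (x.1.1, x.2) x.1.2 ->
    exists x', [/\ F x'.1.1 x'.2, G (x'.1.1, x'.2) x'.1.2 &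
      `|x' - x| <= kappa * `|a|].
Proof.
move=> [_ [kappa kappa0 near_sub]].
have [D D0 hD] := @enorm_equiv R (('rV[R]_n * 'rV[R]_s) * 'rV[R]_m)%type.
have [D' D'0 hD'] := @enorm_equiv R 'rV[R]_m.
(* [D] and [D'] convert between [enorm] and the library norm. The factor 2 makes the distance bound
   strict, so that an actual point realizes it although the infimum may not be attained; this
   requires treating [a = 0] separately. *)
exists (D * (2 * kappa * D')); first by rewrite !mulr_gt0.
apply: filterS near_sub => -[[z1 w1] l1] sub a /= Fa Gw.
have [a0|a_neq0] := eqVneq a 0.
  rewrite a0 add0r in Fa.
  by exists (z1, w1, l1); rewrite subrr a0 !normr0 mulr0.
have ea0 : 0 < enorm a.
  have [na _] := hD' a; rewrite -(pmulr_rgt0 _ D'0).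
  by apply: lt_le_trans na; rewrite normr_gt0.
have dist_a : (dist (0, 0)%R (calHhat F G (z1, w1, l1)) <= (enorm a)%:E)%E.
  apply: ereal_inf_lbound; exists (a, 0).
    split=> /=; first by exists (a + l1) => //; rewrite addrK.
    by exists w1 => //; rewrite subrr.
  congr _%:E; rewrite [LHS]/enorm/= /prod_enorm /= !subr0.
  by rewrite -(scale0r (0 : 'rV[R]_s)) enormZ normr0 mul0r addr0.
have : (dist (z1, w1, l1) (inverse_map (calHhat F G) (0, 0)%R) <
    (2 * kappa * enorm a)%:E)%E.
  apply: (le_lt_trans sub).
  apply: (@le_lt_trans _ _ (kappa%:E * (enorm a)%:E)%E).
    by apply: lee_wpmul2l => //; rewrite lee_fin ltW.
  by rewrite -EFinM lte_fin ltr_pM2r// ltr_pMl// ltr1n.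
move=> /ereal_inf_lt [_ [[[z2 w2] l2] [[y Fy /= yl] [v Gv /= vw]] <-]].
rewrite lte_fin => lt2; exists (z2, w2, l2); split=> /=.
- by rewrite -(subr0_eq yl).
- by rewrite -(subr0_eq vw).
have [nle _] := hD ((z2, w2, l2) - (z1, w1, l1)).
have [_ ale] := hD' a.
apply: (le_trans nle); rewrite -[leRHS]mulrA ler_pM2l//.
apply: (le_trans (ltW lt2)).
by rewrite -[leRHS]mulrA ler_pM2l// mulr_gt0.
Qed.

(** The displacement [u] of the pair [(z, v)] need not end on the graph of [Hmap], but a correction
    [v] of size at most [kappa * |a|] brings it there. The normal inequality is applied to [u + v],
    and the cost of [v] is charged to the slack [a]. The constant [c] is chosen before [q], [xi] and
    [e]. *)
Lemma calH_estimate (z : 'rV[R]_n) (lam : 'rV[R]_m) (b : R) :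
  metrically_subregular (calHhat F G) (z, 0, lam) (0, 0) ->
  exists2 c, 0 <= c &
    \forall q \near (z, 0 : 'rV[R]_s, lam), forall xi (e : R),
      F q.1.1 q.2 -> G (q.1.1, q.2) q.1.2 ->
      regular_normal_cone (graph (Hmap F G)) q.1 xi -> `|xi| <= b -> 0 < e ->
      let q' : T := ((q.1.1, q.2), (0, q.1.2)) in
      \forall p \near q', graph (calH F G) p ->
        inner ((xi.1, 0), (0, xi.2)) (p - q') <=
          e * inorm (p - q' - slack_proj (p - q')) +
          c * inorm (slack_proj (p - q')).
Proof.
move=> /dist_inverse_calHhat[kappa kappa0 /nbhs_normP[rho rho0 near_dist]].
have {}rho0 : 0 < rho := rho0.
have fdH : finite_dimensional ('rV[R]_n * 'rV[R]_s)%type.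
  by apply: finite_dimensional_prod; exact: finite_dimensional_rV.
have [C C0 hC] := normr_inner_le_norm fdH.
have [[D D0 hD] _] := finite_dimensional_calH_space.
have b0 : 0 <= `|b| := normr_ge0 b.
(* The term 1 pays for [e1 * |v|] and [C * |b|] for [- inner xi v]; [kappa * D] bounds [|v|] by the
   norm of the slack. *)
exists ((1 + C * `|b|) * kappa * D).
  by rewrite !mulr_ge0 ?addr_ge0 ?mulr_ge0// ltW.
apply/nbhs_normP; exists (rho / 2); first by rewrite /= divr_gt0.
move=> [[z1 w1] l1] q_near xi e /= Fl Gw Nxi xib e0.
(* The bound by 1 keeps the coefficient of [|v|] independent of [e]; the bound by [e / D] absorbs
   the change of norm for [u]. *)
pose e1 := Num.min 1 (e / D).
have e10 : 0 < e1 by rewrite lt_min ltr01 divr_gt0.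
have [e1_1 e1_e] : e1 <= 1 /\ e1 <= e / D.
  by split; rewrite ge_min lexx ?orbT.
have /nbhs_normP[r r0 hr] := regular_normal_le fdH _ _ _ _ Nxi e10.
have {}r0 : 0 < r := r0.
(* The first radius keeps [(z2, v2, l2)] where [near_dist] applies; the second gives [|u + v| < r],
   as [|u + v| <= (1 + kappa) * |d|]. *)
apply/nbhs_normP; exists (Num.min (rho / 2) (r / (kappa + 1))).
  by rewrite /= lt_min !divr_gt0// addr_gt0.
move=> [[z2 l2] [a v2]]; rewrite /ball_ /= distrC lt_min => /andP[d_rho d_r].
move=> /graph_calHP/= [Fa Gv].
set d : T := _ - _ in d_rho d_r *.
have dE : d = ((z2 - z1, l2 - l1), (a, v2 - w1)) by rewrite /d -[a in RHS]subr0.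
have [dz [dl [da dv]]] : `|z2 - z1| <= `|d| /\ `|l2 - l1| <= `|d| /\
    `|a| <= `|d| /\ `|v2 - w1| <= `|d|.
  by rewrite dE !prod_normE/= !le_max !lexx !orbT.
have xd : `|(z2, v2, l2) - (z1, w1, l1)| <= `|d|.
  by rewrite !prod_normE/= !ge_max dz dv dl.
have [|x' [F' G' x'_le]] := near_dist (z2, v2, l2) _ a Fa Gv.
  rewrite /ball_ /= in q_near *.
  have := ler_normD ((z, 0, lam) - (z1, w1, l1)) ((z1, w1, l1) - (z2, v2, l2)).
  by rewrite addrA subrK (distrC (z1, w1, l1)); lra.
have qH : graph (Hmap F G) x'.1 by exists x'.2.
pose u := (z2, v2) - (z1, w1); pose v := x'.1 - (z2, v2).
have v_le : `|v| <= kappa * `|a|.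
  by apply: le_trans x'_le; rewrite [leRHS]prod_normE le_max lexx.
have uE : u = (z2 - z1, v2 - w1) by [].
have u_le : `|u| <= `|d| by rewrite uE prod_normE/= ge_max dz dv.
have uvE : x'.1 - (z1, w1) = u + v by rewrite [RHS]addrC /v /u addrA subrK.
have uv_r : `|u + v| < r.
  apply: (le_lt_trans (ler_normD _ _)).
  have : (kappa + 1) * `|d| < r by rewrite mulrC -ltr_pdivlMr// addr_gt0.
  have : kappa * `|a| <= kappa * `|d| by rewrite ler_pM2l.
  lra.
have := hr x'.1 _ qH; rewrite /ball_ /= distrC uvE => /(_ uv_r) uv_le.
have -> : inner ((xi.1, 0), (0, xi.2)) d = inner xi u :> R.
  rewrite dE uE [LHS]/inner/= /prod_inner/= [RHS]/inner/= /prod_inner/=.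
  rewrite [inner (_, _) _]/inner/= /prod_inner/=.
  by rewrite [X in _ + X]/inner/= /prod_inner/= !inner0l addr0 add0r.
have u_le_inorm : `|u| <= D * inorm (d - slack_proj d).
  have [+ _] := hD (d - slack_proj d); apply: le_trans.
  rewrite dE uE !prod_normE/= !subr0.
  by rewrite ge_max !le_max !lexx !orbT.
have a_le_inorm : `|a| <= D * inorm (slack_proj d).
  have [+ _] := hD (slack_proj d); apply: le_trans.
  by rewrite dE !prod_normE/= !le_max lexx !orbT.
have v_le_inorm : `|v| <= kappa * (D * inorm (slack_proj d)).
  by apply: (le_trans v_le); rewrite ler_pM2l.
have e1u : e1 * `|u| <= e * inorm (d - slack_proj d).
  apply: (le_trans (ler_wpM2r (normr_ge0 _) e1_e)).
  by rewrite -mulrA ler_pM2l// mulrC ler_pdivrMr// mulrC.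
have xiv : - inner xi v <= C * `|b| * `|v|.
  rewrite -innerNr; apply: (le_trans (ler_norm _)); apply: (le_trans (hC _ _)).
  rewrite -[leRHS]mulrA ler_pM2l// normrN ler_wpM2r//.
  exact: le_trans xib (ler_norm _).
have vc : (1 + C * `|b|) * `|v| <=
    (1 + C * `|b|) * kappa * D * inorm (slack_proj d).
  rewrite -[leRHS]mulrA -[leRHS]mulrA ler_wpM2l//.
  by rewrite addr_ge0// mulr_ge0// ltW.
have e1uv : e1 * `|u + v| <= e1 * `|u| + `|v|.
  apply: (@le_trans _ _ (e1 * (`|u| + `|v|))).
    by rewrite ler_pM2l// ler_normD.
  by rewrite mulrDr lerD2l ler_piMl.
move: uv_le; rewrite (innerDr xi u v); lra.
Qed.

End calH_graph.

(** * Coderivatives of [Hmap] in terms of those of [calH], and the stationarity result *)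

Lemma coderivative_Hmap (R : realType) (n m s : nat)
    (F : 'rV[R]_n -> set 'rV[R]_m) (G : 'rV[R]_n * 'rV[R]_m -> set 'rV[R]_s)
    (z xi : 'rV[R]_n) (nu : 'rV[R]_s) :
  closed (graph F) -> closed (graph G) ->
  inner_semicompact (Khatmap F G) (z, 0) (dom (Khatmap F G)) ->
  (forall lam, Kmap F G z lam ->
    metrically_subregular (calHhat F G) (z, 0, lam) (0, 0)) ->
  coderivative (Hmap F G) z 0 nu xi ->
  exists lam mu, Kmap F G z lam /\
    coderivative (calH F G) (z, lam) (0, 0) (mu, nu) (xi, 0).
Proof.
move=> cF cG [_ semicompact] subregular [u [eta [Hu uz Neta eta_xi]]].
have [|phi [v [lam [phi_homo v_lam Kv]]]] := semicompact u _ uz.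
  by move=> k; case: (Hu k) => l Fl Gl; exists l.
have phi_ge l : (l <= phi l)%N.
  by elim: l => // l IH; apply: leq_ltn_trans IH (phi_homo _ _ (ltnSn l)).
have uphi := cvg_subseq u _ phi phi_ge uz.
have eta_phi := cvg_subseq eta _ phi phi_ge eta_xi.
have u1 : (u (phi l)).1 @[l --> \oo] --> z.
  by apply: cvg_comp uphi _; exact: cvg_fst.
have u2 : (u (phi l)).2 @[l --> \oo] --> (0 : 'rV[R]_s).
  by apply: cvg_comp uphi _; exact: cvg_snd.
have u1v : ((u (phi l)).1, v l) @[l --> \oo] --> (z, lam).
  exact: (@cvg_pair _ _ _ \oo (nbhs z) (nbhs lam)).
have Klam : Kmap F G z lam.
  split.
    have := @closed_cvg _ _ \oo _ (fun l => ((u (phi l)).1, v l))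
      (graph F) cF _ _ u1v.
    by apply; apply: nearW => l; case: (Kv l).
  have := @closed_cvg _ _ \oo _ (fun l => (((u (phi l)).1, v l), (u (phi l)).2))
    (graph G) cG _ ((z, lam), 0).
  apply; first by apply: nearW => l; case: (Kv l).
  exact: (@cvg_pair _ _ _ \oo (nbhs (z, lam)) (nbhs (0 : 'rV[R]_s))).
exists lam.
(* The normals [eta (phi l)] are eventually within 1 of [(xi, - nu)]; this norm bound lets [c] be
   fixed before [e]. *)
have [c c0 est] :=
  calH_estimate _ _ _ _ (`|(xi, - nu)| + 1) (subregular _ Klam).
have [|y Py Ny] := @limiting_normal_penalized _ _ finite_dimensional_calH_space
    slack_proj slack_proj_linear slack_proj_sym (fun=> erefl)
    (graph (calH F G)) ((z, lam), (0, 0)) ((xi, 0), (0, - nu)) c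
    (closed_graph_calH _ _ cF cG) c0.
  move=> e e0.
  have uv : (u (phi l), v l) @[l --> \oo] --> ((z, 0 : 'rV[R]_s), lam).
    exact: (@cvg_pair _ _ _ \oo (nbhs (z, 0 : 'rV[R]_s)) (nbhs lam)).
  have [N _ est_N] := uv _ est.
  near \oo => l.
  have uv_e : `|((z, 0), lam) - (u (phi l), v l)| < e.
    by near: l; move/cvgrPdist_lt: uv => /(_ _ e0).
  have eta_e : `|(xi, - nu) - eta (phi l)| < e.
    by near: l; move/cvgrPdist_lt: eta_phi => /(_ _ e0).
  have eta_1 : `|(xi, - nu) - eta (phi l)| < 1.
    by near: l; move/cvgrPdist_lt: eta_phi => /(_ _ ltr01).
  have [Fv Gv] := Kv l.
  have [Hul Nl] := (Hu (phi l), Neta (phi l)).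
  (* The lifted point has zero slack because [v l] belongs to [F (u (phi l)).1]; the normal is
     padded with zeros in the [lam] and slack components. *)
  exists (((u (phi l)).1, v l), (0, (u (phi l)).2)).
  exists (((eta (phi l)).1, 0), (0, (eta (phi l)).2)).
  split.
  - by apply/graph_calHP; rewrite /= add0r.
  - rewrite distrC; move: uv_e; rewrite !prod_normE/= !gt_max subrr normr0 e0/=.
    by move=> /andP[/andP[-> ->] ->].
  - rewrite distrC; move: eta_e.
    rewrite !prod_normE/= !gt_max !subrr !normr0 e0/=.
    by move=> /andP[-> ->].
  - have : `|eta (phi l)| <= `|(xi, - nu)| + 1.
      have := ler_normB (xi, - nu) ((xi, - nu) - eta (phi l)).
      by rewrite opprB addrC subrK; lra.
    move=> eta_b; have Nl' : (N <= l)%N by near: l; exact: nbhs_infty_ge.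
    exact: est_N Nl' _ _ Fv Gv Nl eta_b e0.
exists y.2.1; split; first exact: Klam.
rewrite /coderivative /mkset.
(* As [y] is fixed by [slack_proj], only its slack component survives. *)
have <- : ((xi, 0), (0, - nu)) - y = ((xi, 0), - (y.2.1, nu)).
  by rewrite -Py; congr ((_, _), (_, _)); rewrite /= ?subr0 ?sub0r.
exact: Ny.
Unshelve. all: by end_near. Qed.

Theorem proposition4p17 (R : realType) (n m s : nat)
  (f : 'rV[R]_n -> R^o)
  (F : 'rV[R]_n -> set 'rV[R]_m)
  (G : 'rV[R]_n * 'rV[R]_m -> set 'rV[R]_s)
  (M : set 'rV[R]_n)
  (f_lipschitz : locally_lipschitz f)
  (F_closed : closed (graph F))
  (G_closed : closed (graph G))
  (M_nonempty : M !=set0)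
  (M_closed : closed M)
  (H_closed : locally_closed (graph (Hmap F G)))
  (z : 'rV[R]_n)
  (z_stationary : implicitly_M_stationary f F G M z)
  (Khat_semicompact :
    inner_semicompact (Khatmap F G) (z, 0) (dom (Khatmap F G)))
  (Hhat_subregular : forall lam : 'rV[R]_m, Kmap F G z lam ->
    metrically_subregular (calHhat F G) (z, 0, lam) (0, 0)) :
  fuzzily_M_stationary f F G M z /\
  ((forall lam : 'rV[R]_m, Kmap F G z lam ->
      forall (mu : 'rV[R]_m) (nu : 'rV[R]_s),
        coderivative (calH F G) (z, lam) (0, 0) (mu, nu) `<=`
        (coderivative F z lam mu `*` [set - mu])
        \oplus coderivative G (z, lam) 0 nu) ->
   explicitly_M_stationary f F G M z).
Proof.
have [feas [nu [_ [x fx [xi Hxi <-]] [y My xy0]]]] := z_stationary.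
have [lam [mu [Klam Hmu]]] := coderivative_Hmap _ _ _ _ _ _ _ _ _ F_closed
  G_closed Khat_semicompact Hhat_subregular Hxi.
split.
  split; first exact: feas.
  exists lam, mu, nu; split; first exact: Klam.
  exists (x + xi, 0); last first.
    by exists (y, 0) => //; congr (_, _); rewrite //= addr0.
  by exists (x, 0) => //; exists (xi, 0) => //; congr (_, _); rewrite /= addr0.
move=> qualif; split; first exact: feas.
exists lam, mu, nu; split; first exact: Klam.
have [[a b] [/= Fa ->] [[c d] Gcd [acE bdE]]] := qualif _ Klam _ _ _ Hmu.
(* The [lam] component of the coderivative element is 0, so [bdE] reads [- mu + d = 0]; this matches
   the [mu] of the [F] term with the one in the [G] term. *)
have dmu : d = mu by apply/eqP; rewrite -subr_eq0 addrC; apply/eqP.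
rewrite dmu in Gcd.
exists (x + a + c); last by exists y => //; rewrite -xy0 -acE addrA.
by exists (x + a); [exists x => //; exists a|exists c].
Qed.
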